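(* Let $N\ge 3$. To each critical value $\frac{\theta}{2}$ of the injectivity radius $\rho$ on $\mathrm{Conf}(N)$, there exists a balanced configuration $\mathbf U\in\mathrm{Conf}(N)$ with $\rho(\mathbf U)=\frac{\theta}{2}$. The vertices of the contact graph of $\mathbf U$ are a subset of the points in $\mathbf U$, and the geodesic edges of the contact graph all have length $\theta$.
   Context: $\mathrm{Conf}(N)\subset(\mathbb S^2)^N$ is the space of $N$-tuples $\mathbf U=(\mathbf u_1,\dots,\mathbf u_N)$ of distinct labeled points of the unit sphere $\mathbb S^2\subset\mathbb R^3$. For $\mathbf u,\mathbf v\in\mathbb S^2$, $\theta(\mathbf u,\mathbf v)\in[0,\pi]$ is the angular distance. The injectivity radius function is $\rho(\mathbf U)=\frac12\min_{i\ne j}\theta(\mathbf u_i,\mathbf u_j)$. Criticality: for a tangent vector $\mathbf V=(\mathbf v_1,\dots,\mathbf v_N)$ to $\mathrm{Conf}(N)$ at $\mathbf U$ (so $\mathbf v_i\in T_{\mathbf u_i}\mathbb S^2$) and small $t$, put $\mathbf U\#t\mathbf V=\left(\frac{\mathbf u_1+t\mathbf v_1}{|\mathbf u_1+t\mathbf v_1|},\dots,\frac{\mathbf u_N+t\mathbf v_N}{|\mathbf u_N+t\mathbf v_N|}\right)$. The configuration $\mathbf U$ is critical for maximizing $\rho$ if for every such $\mathbf V$ one has $[\rho(\mathbf U\#t\mathbf V)-\rho(\mathbf U)]_+=o(t)$ as $t\to0$, where $[g]_+=\max\{g,0\}$; otherwise $\mathbf U$ is regular. A critical value of $\rho$ is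 a value $\rho(\mathbf U)$ at a configuration $\mathbf U$ that is critical for maximizing $\rho$. Contact graph of $\mathbf U$: with $\theta=2\rho(\mathbf U)$, the graph embedded in $\mathbb S^2$ whose vertices are the points $\mathbf u_i$ and whose edges are the (minimizing) geodesic segments $[\mathbf u_i,\mathbf u_j]$ for all pairs with $\theta(\mathbf u_i,\mathbf u_j)=\theta$. A stress graph for $\mathbf U$ is the contact graph together with weights $w_e\ge 0$ on its edges. An edge $e=[\mathbf u_i,\mathbf u_j]$ exerts at each of its endpoints $\mathbf u$ a tangential force $w_e\,T_e|_{\mathbf u}$, where $T_e|_{\mathbf u}\in T_{\mathbf u}\mathbb S^2$ is the outward unit tangent vector to $e$ at the endpoint $\mathbf u$. The stress graph is balanced if at every point $\mathbf u_i$ the vector sum of these forces in $T_{\mathbf u_i}\mathbb S^2$ is zero. The configuration $\mathbf U$ is balanced if its contact graph has a balanced stress graph for some choice of nonnegative, not everywhere zero weights. *)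

(* Defs.v *)
From HB Require Import structures.
From mathcomp Require Import all_boot all_order all_algebra.
From mathcomp Require Import all_classical all_reals all_analysis.

Set Implicit Arguments.
Unset Strict Implicit.
Unset Printing Implicit Defensive.

Import Order.TTheory GRing.Theory Num.Theory.
Import numFieldNormedType.Exports.

Local Open Scope classical_set_scope.
Local Open Scope ring_scope.

(* The library norm on ['rV[R]_3] is the sup norm, hence the Euclidean norm
   [enorm]. *)
Definition dot (R : realType) (u v : 'rV[R]_3) : R :=
  \sum_(k < 3) u 0 k * v 0 k.

Definition enorm (R : realType) (u : 'rV[R]_3) : R := Num.sqrt (dot u u).

Definition normalize (R : realType) (u : 'rV[R]_3) : 'rV[R]_3 :=
  (enorm u)^-1 *: u.

Definition sphere (R : realType) : set 'rV[R]_3 := [set u | enorm u = 1].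

Definition tangent (R : realType) (u : 'rV[R]_3) : set 'rV[R]_3 :=
  [set v | dot u v = 0].

Definition angle (R : realType) (u v : 'rV[R]_3) : R := acos (dot u v).

Definition Conf (R : realType) (N : nat) : set ('I_N -> 'rV[R]_3) :=
  [set U | (forall i, sphere (U i)) /\ injective U].

(* Angles are at most [pi], so the neutral element [pi] does not affect the
   minimum as soon as [2 <= N]. *)
Definition rho (R : realType) (N : nat) (U : 'I_N -> 'rV[R]_3) : R :=
  2^-1 * \big[Num.min/pi]_(p : 'I_N * 'I_N | p.1 != p.2)
           angle (U p.1) (U p.2).

(* U # tV *)
Definition displace (R : realType) (N : nat) (U V : 'I_N -> 'rV[R]_3) (t : R) :
    'I_N -> 'rV[R]_3 :=
  fun i => normalize (U i + t *: V i).

Definition critical (R : realType) (N : nat) (U : 'I_N -> 'rV[R]_3) : Prop :=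
  forall V : 'I_N -> 'rV[R]_3, (forall i, tangent (U i) (V i)) ->
    (fun t : R => Num.max (rho (displace U V t) - rho U) 0)
      =o_ (0 : R) (fun t : R => t).

Definition critical_value (R : realType) (N : nat) (r : R) : Prop :=
  exists U : 'I_N -> 'rV[R]_3, [/\ Conf U, critical U & rho U = r].

(* Unit tangent vector at [u] pointing along the minimizing geodesic towards
   [v]: the normalized projection of [v] to the tangent plane at [u].
   It is meaningful for [u], [v] on the sphere, neither equal nor antipodal. *)
Definition direction (R : realType) (u v : 'rV[R]_3) : 'rV[R]_3 :=
  normalize (v - dot u v *: u).

(* The minimizing geodesic from [u] to [v], parametrized by [0, 1] with
   constant speed. *)
Definition geodesic (R : realType) (u v : 'rV[R]_3) : R -> 'rV[R]_3 :=
  fun s => cos (s * angle u v) *: u + sin (s * angle u v) *: direction u v.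

(* Outward unit tangent at the endpoint [u] of the edge [u, v]: it points out
   of the edge, i.e. away from [v]. *)
Definition outward (R : realType) (u v : 'rV[R]_3) : 'rV[R]_3 :=
  - direction u v.

(* Length of a curve [0, 1] -> S^2 for the angular metric: supremum, over the
   partitions of [0, 1], of the sum of successive distances. *)
Definition curve_length (R : realType) (c : R -> 'rV[R]_3) : \bar R :=
  ereal_sup [set (\sum_(0 <= n < size s)
      angle (c (nth 1 (0 :: s) n)) (c (nth 1 (0 :: s) n.+1)))%:E
    | s in itv_partition (0 : R) 1].

Definition contact (R : realType) (N : nat) (U : 'I_N -> 'rV[R]_3) :
    rel 'I_N :=
  fun i j => (i != j) && (angle (U i) (U j) == 2 * rho U).

Definition contact_vertices (R : realType) (N : nat)
    (U : 'I_N -> 'rV[R]_3) : set 'rV[R]_3 := range U.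

(* Each unoriented edge is listed with its two parametrizations. *)
Definition contact_edges (R : realType) (N : nat)
    (U : 'I_N -> 'rV[R]_3) : set (R -> 'rV[R]_3) :=
  [set e | exists i j, contact U i j /\ e = geodesic (U i) (U j)].

(* Weights on unoriented edges are symmetric functions of the two labels; only
   the values on contact edges matter. *)
Definition stress (R : realType) (N : nat) (U : 'I_N -> 'rV[R]_3)
    (w : 'I_N -> 'I_N -> R) : Prop :=
  forall i j, contact U i j -> 0 <= w i j /\ w i j = w j i.

Definition balanced_stress (R : realType) (N : nat) (U : 'I_N -> 'rV[R]_3)
    (w : 'I_N -> 'I_N -> R) : Prop :=
  stress U w /\
  forall i, \sum_(j | contact U i j) w i j *: outward (U i) (U j) = 0.

Definition balanced (R : realType) (N : nat) (U : 'I_N -> 'rV[R]_3) : Prop :=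
  exists w : 'I_N -> 'I_N -> R,
    balanced_stress U w /\ exists i j, contact U i j /\ w i j != 0.

(* Main.v *)
Require Import Defs.
From mathcomp Require Import all_boot all_order all_algebra.
From mathcomp Require Import all_classical all_reals all_analysis.
From mathcomp Require Import ring lra.
Import Order.TTheory GRing.Theory Num.Theory.
Import numFieldNormedType.Exports.
Local Open Scope classical_set_scope.
Local Open Scope ring_scope.

(** A configuration that is critical for maximizing [rho] is itself balanced,
so the critical configuration realizing the given value is the one required.

To first order, moving a configuration [U] along a tangent vector [V] changes
the angle of a contact pair [(i, j)] at the rate
[dot (V i) (outward (U i) (U j)) + dot (V j) (outward (U j) (U i))], which is
linear in [V].  If some [V] made all these rates positive, every contact angle
would grow at least linearly in [t]; the other angles exceed [2 * rho U] and
stay above it by continuity, so [rho] itself would grow at least linearly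
([rho_displace]), contradicting criticality ([critical_no_ascent]).  Hence the
finitely many linear rates have no common positive vector, and Gordan's
alternative ([gordan]) provides nonnegative weights, not all zero, for which
the weighted sum of the rates vanishes identically.  Evaluating this identity
on vectors [V] supported at a single point says exactly that the forces at this
point add up to zero ([critical_balanced]).

All of this takes place away from the singularities of [acos] and of
[direction]: contact angles are positive because the points are distinct, and
smaller than [pi] because three distinct points cannot be pairwise antipodal
([two_rho_lt_pi]).  For the same reason the edges are genuine great circle
arcs, parametrized with constant speed, so the sums of successive distances
along a partition telescope to the angle of the endpoints
([curve_length_geodesic]). *)

(** * Gordan's alternative *)

(** Here [P i e] stands for: [e] is small enough for the condition [i].  A
minimum of finitely many thresholds is positive, which is how finiteness of the
set of pairs enters. *)
Lemma common_threshold {R : realDomainType} {I : eqType} (s : seq I)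
    (P : I -> R -> Prop) :
  (forall i d e, 0 < d -> d <= e -> P i e -> P i d) ->
  (forall i, i \in s -> exists2 e, 0 < e & P i e) ->
  exists2 e, 0 < e & forall i, i \in s -> P i e.
Proof.
move=> Pmono; elim: s => [|i s IHs] Ps; first by exists 1.
have [j js|d d_gt0 Pd] := IHs; first by apply: Ps; rewrite inE js orbT.
have [e e_gt0 Pe] := Ps i (mem_head i s).
have m_gt0 : 0 < Num.min d e by rewrite lt_min d_gt0.
exists (Num.min d e) => // j; rewrite inE => /predU1P[->|js].
  by apply: Pmono Pe; rewrite // ge_min lexx orbT.
by apply: Pmono (Pd j js); rewrite // ge_min lexx.
Qed.

Lemma slack_lt {R : realFieldType} (l b : R) : 0 <= l -> 0 < b ->
  0 < b / (l + 1) /\ l * (b / (l + 1)) < b.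
Proof.
move=> l0 b0; have l1 : 0 < l + 1 by lra.
split; first exact: divr_gt0.
by rewrite mulrA ltr_pdivrMr //; nra.
Qed.

(** Induction on the number of functionals.  When a solution [x] for [s] fails
for the next functional [a k], either [a k x = 0] and [x] can be perturbed, or
[a k x < 0] and the functionals of [s] can be shifted by nonnegative multiples
of [a k] so as to vanish at [x].  A solution for the shifted functionals can
then be translated along [x] until [a k] is small and positive, whereas a
dependency between them unfolds to one that involves [a k]. *)
Lemma gordan {R : realFieldType} {V : lmodType R} {I : eqType} (s : seq I)
    (a : I -> V -> R) :
  uniq s -> (forall i, scalar (a i)) ->
  (exists x, forall i, i \in s -> 0 < a i x) \/
  exists w : I -> R, [/\ forall i, 0 <= w i,
    exists2 i, i \in s & 0 < w i & forall x, \sum_(i <- s) w i * a i x = 0].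
Proof.
elim: s a => [|k s IHs] a /=; first by left; exists 0.
move=> /andP[ks us] lin_a.
have aD i x t y : a i (x + t *: y) = a i x + t * a i y.
  by rewrite addrC lin_a addrC.
have off_k (w : I -> R) c x : \sum_(i <- s) (if i == k then c else w i) * a i x
    = \sum_(i <- s) w i * a i x.
  rewrite !big_seq; apply: eq_bigr => i si; case: eqP => // ik.
  by rewrite -ik si in ks.
have [[x ax_gt0]|[w [w_ge0 [i si wi_gt0] sum_w]]] := IHs a us lin_a; last first.
  right; exists (fun i => if i == k then 0 else w i); split.
  - by move=> j; case: ifP.
  - exists i; first by rewrite inE si orbT.
    by case: eqP => // ik; rewrite -ik si in ks.
  - by move=> x; rewrite big_cons eqxx mul0r add0r off_k.
have [|z0] := pselect (forall z, a k z = 0).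
  move=> ak0; right; exists (fun i => if i == k then 1 else 0); split.
  - by move=> j; case: ifP.
  - by exists k; rewrite ?mem_head ?eqxx.
  - move=> y; rewrite big_cons eqxx ak0 mulr0 add0r off_k.
    by rewrite big1 // => i _; rewrite mul0r.
have [z akz] : exists z, a k z != 0.
  apply: contrapT => nz; apply: z0 => z; apply/eqP/negPn/negP => h.
  by apply: nz; exists z.
have [akx_gt0|akx_lt0|akx0] := ltrgtP 0 (a k x).
- by left; exists x => i; rewrite inE => /predU1P[->|/ax_gt0].
- (* The value outside [s] only serves to make [l] nonnegative everywhere. *)
  pose l i := if i \in s then - (a i x / a k x) else 0.
  have l_ge0 i : 0 <= l i.
    rewrite /l; case: ifP => // si.
    by rewrite oppr_ge0 mulr_ge0_le0 ?(ltW (ax_gt0 _ si)) // invr_le0 ltW.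
  pose b i y := a i y + l i * a k y.
  have lin_b i : scalar (b i).
    by move=> c y y'; rewrite /b !lin_a; ring.
  have bx0 i : i \in s -> b i x = 0.
    by move=> si; rewrite /b /l si; field; rewrite lt_eqF.
  have [[y by_gt0]|[w [w_ge0 [i si wi_gt0] sum_w]]] := IHs b us lin_b.
    left.
    have [|i si|e e_gt0 He] := @common_threshold R I s (fun i e => l i * e < b i y).
    + move=> i d e _ de; apply: le_lt_trans.
      by rewrite ler_wpM2l.
    + have [] := slack_lt (l i) (b i y) (l_ge0 i) (by_gt0 i si).
      by exists (b i y / (l i + 1)).
    + (* With this translation [a k] takes the value [e] and no [b i] changes. *)
      pose t := (e - a k y) / a k x.
      have aky' : a k (y + t *: x) = e.
        by rewrite aD /t; field; rewrite lt_eqF.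
      exists (y + t *: x) => i; rewrite inE => /predU1P[->|si]; first by rewrite aky'.
      have := He i si.
      have : b i (y + t *: x) = b i y.
        rewrite addrC /b !(lin_a _ t) mulrDr addrACA [l i * (t * _)]mulrCA.
        by rewrite -mulrDr [_ + _ * a k x](bx0 _ si) mulr0 add0r.
      by rewrite {1}/b aky' => <-; rewrite ltrDr.
  right; exists (fun i => if i == k then \sum_(j <- s) w j * l j else w i); split.
  - by move=> j; case: ifP => // _; apply: sumr_ge0 => m _; rewrite mulr_ge0.
  - exists i; first by rewrite inE si orbT.
    by case: eqP => // ik; rewrite -ik si in ks.
  - move=> y; rewrite big_cons eqxx off_k -[RHS](sum_w y) mulr_suml -big_split /=.
    by apply: eq_bigr => j _; rewrite /b; ring.
- left; pose z' := (a k z)^-1 *: z.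
  have akz' : a k z' = 1.
    have a0 : a k 0 = 0.
      by have := lin_a k (-1) 0 0; rewrite scaler0 addr0 mulN1r addNr.
    by rewrite /z' -[_ *: z]add0r aD mulVf // a0 add0r.
  have [|i si|e e_gt0 He] := @common_threshold R I s (fun i e => `|a i z'| * e < a i x).
  + by move=> i d e _ de; apply: le_lt_trans; rewrite ler_wpM2l.
  + have [] := slack_lt `|a i z'| (a i x) (normr_ge0 _) (ax_gt0 i si).
    by exists (a i x / (`|a i z'| + 1)).
  + exists (x + e *: z') => i; rewrite inE aD => /predU1P[->|si].
      by rewrite -akx0 akz' mulr1 add0r.
    have := He i si; have := ler_norm (- a i z'); rewrite normrN.
    by move=> h; have := ler_wpM2r (ltW e_gt0) h; lra.
Qed.

(** * Euclidean geometry *)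

Section Euclid.
Context {R : realType}.
Implicit Types u v x y : 'rV[R]_3.

Lemma dotC u v : dot u v = dot v u.
Proof. by apply: eq_bigr => k _; rewrite mulrC. Qed.

Lemma dotDZl c u v x : dot (c *: u + v) x = c * dot u x + dot v x.
Proof.
rewrite /dot mulr_sumr -big_split /=; apply: eq_bigr => k _.
by rewrite !mxE; ring.
Qed.

Lemma dot0l x : dot 0 x = 0.
Proof. by rewrite /dot big1 // => k _; rewrite mxE mul0r. Qed.

Lemma dotDl u v x : dot (u + v) x = dot u x + dot v x.
Proof. by rewrite -[u]scale1r dotDZl mul1r scale1r. Qed.

Lemma dotZl c u x : dot (c *: u) x = c * dot u x.
Proof. by rewrite -[_ *: _]addr0 dotDZl dot0l addr0. Qed.

Lemma dotNl u x : dot (- u) x = - dot u x.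
Proof. by rewrite -scaleN1r dotZl mulN1r. Qed.

Lemma dotDr u v x : dot x (u + v) = dot x u + dot x v.
Proof. by rewrite ![dot x _]dotC dotDl. Qed.

Lemma dotZr c u x : dot x (c *: u) = c * dot x u.
Proof. by rewrite ![dot x _]dotC dotZl. Qed.

Lemma dotNr u x : dot x (- u) = - dot x u.
Proof. by rewrite ![dot x _]dotC dotNl. Qed.

Definition dotE := (dotDl, dotDr, dotZl, dotZr, dotNl, dotNr).

Lemma dot_suml (I : Type) (r : seq I) (P : pred I) (F : I -> 'rV[R]_3) x :
  dot (\sum_(i <- r | P i) F i) x = \sum_(i <- r | P i) dot (F i) x.
Proof.
elim: r => [|i r IHr]; rewrite ?big_nil ?dot0l // !big_cons.
by case: ifP => _; rewrite ?dotDl IHr.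
Qed.

Lemma dot_ge0 u : 0 <= dot u u.
Proof. by apply: sumr_ge0 => k _; rewrite -expr2 sqr_ge0. Qed.

Lemma dot_eq0 u : dot u u = 0 -> u = 0.
Proof.
move=> /eqP; rewrite psumr_eq0 => [/allP h|k _]; last by rewrite -expr2 sqr_ge0.
apply/rowP => k; have := h k (mem_index_enum _); rewrite /= mulf_eq0 orbb mxE.
by move/eqP.
Qed.

Lemma sphereP u : sphere u -> dot u u = 1.
Proof.
by rewrite /sphere /= /enorm => h; rewrite -[LHS]sqr_sqrtr ?dot_ge0 // h expr1n.
Qed.

Lemma sphere_dot_itv u v : sphere u -> sphere v -> -1 <= dot u v <= 1.
Proof.
move=> /sphereP uu /sphereP vv.
have := dot_ge0 (u + v); have := dot_ge0 (u - v).
by rewrite !dotE uu vv (dotC v u); lra.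
Qed.

Lemma dot_sphere_eq1 u v : sphere u -> sphere v -> dot u v = 1 -> u = v.
Proof.
move=> /sphereP uu /sphereP vv uv; apply/eqP; rewrite -subr_eq0; apply/eqP/dot_eq0.
by rewrite !dotE uu vv (dotC v u) uv; ring.
Qed.

Lemma dot_sphere_eqN1 u v : sphere u -> sphere v -> dot u v = -1 -> u = - v.
Proof.
move=> /sphereP uu /sphereP vv uv; apply/eqP; rewrite -addr_eq0; apply/eqP/dot_eq0.
by rewrite !dotE uu vv (dotC v u) uv; ring.
Qed.

Lemma sphere_normalize u : 0 < dot u u -> sphere (normalize u).
Proof.
move=> uu; rewrite /sphere /normalize /= /enorm !dotE.
have s0 : 0 < Num.sqrt (dot u u) by rewrite sqrtr_gt0.
have -> : (Num.sqrt (dot u u))^-1 * ((Num.sqrt (dot u u))^-1 * dot u u) = 1.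
  rewrite -[X in _ * (_ * X) = _]sqr_sqrtr ?ltW //; field; exact: lt0r_neq0.
exact: sqrtr1.
Qed.

(** ** Angles *)

Lemma cos_angle u v : sphere u -> sphere v -> cos (angle u v) = dot u v.
Proof. by move=> su sv; rewrite /angle acosK // in_itv /= sphere_dot_itv. Qed.

Lemma angle_itv u v : sphere u -> sphere v -> 0 <= angle u v <= pi.
Proof.
by move=> su sv; rewrite acos_ge0 ?acos_lepi // sphere_dot_itv.
Qed.

Lemma angleC u v : angle u v = angle v u.
Proof. by rewrite /angle dotC. Qed.

Lemma angle_gt0 u v : sphere u -> sphere v -> u <> v -> 0 < angle u v.
Proof.
move=> su sv uv; have /andP[m1 m2] := sphere_dot_itv _ _ su sv.
rewrite acos_gt0 // m1 /= lt_neqAle m2 andbT.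
by apply/eqP => /(dot_sphere_eq1 _ _ su sv).
Qed.

Lemma angle_ltpi u v : sphere u -> sphere v -> u <> - v -> angle u v < pi.
Proof.
move=> su sv uv; have /andP[m1 m2] := sphere_dot_itv _ _ su sv.
rewrite acos_ltpi // m2 andbT lt_neqAle m1 andbT eq_sym.
by apply/eqP => /(dot_sphere_eqN1 _ _ su sv).
Qed.

Lemma cos_dist (a b : R) : a <= b -> cos a - cos b <= b - a.
Proof.
move=> ab.
have [|c _ h] := @MVT_segment R cos (fun z => - sin z) a b ab _.
  exact/continuous_subspaceT/continuous_cos.
have h1 : sin c * (b - a) <= 1 * (b - a) by rewrite ler_wpM2r ?subr_ge0 ?sin_le1.
by lra.
Qed.

(** Since [cos] is 1-Lipschitz, a decrease of the dot product by [d] costs an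
angle of at least [d]; this avoids differentiating [acos]. *)
Lemma angle_growth (th d : R) u v : sphere u -> sphere v -> 0 <= th <= pi ->
  0 <= d -> dot u v <= cos th - d -> th + d <= angle u v.
Proof.
move=> su sv hth d0 h; have hA := angle_itv _ _ su sv.
have le_th : th <= angle u v.
  rewrite leNgt; apply/negP => lt_th.
  have : cos th < cos (angle u v) by rewrite ltr_cos ?in_itv.
  by rewrite cos_angle //; lra.
by have := cos_dist _ _ le_th; rewrite cos_angle //; lra.
Qed.

End Euclid.

(** * Geodesic edges *)

Section Edges.
Context {R : realType}.
Implicit Types u v : 'rV[R]_3.

Lemma directionE u v : sphere u -> sphere v -> 0 < angle u v < pi ->
  direction u v = (sin (angle u v))^-1 *: (v - cos (angle u v) *: u).
Proof.
move=> su sv uv_pi; rewrite /direction /normalize -(cos_angle _ _ su sv).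
have -> // : enorm (v - cos (angle u v) *: u) = sin (angle u v).
rewrite /enorm.
have -> : dot (v - cos (angle u v) *: u) (v - cos (angle u v) *: u)
    = sin (angle u v) ^+ 2.
  rewrite sin2cos2 !dotE (dotC v u) !sphereP // (cos_angle _ _ su sv); ring.
by rewrite sqrtr_sqr gtr0_norm // sin_gt0_pi.
Qed.

Lemma dot_direction u v : sphere u -> sphere v -> 0 < angle u v < pi ->
  dot u (direction u v) = 0 /\ dot (direction u v) (direction u v) = 1.
Proof.
move=> su sv uv_pi; rewrite directionE // !dotE (dotC v u) !sphereP //.
rewrite (cos_angle _ _ su sv); split; first by ring.
have s0 := sin_gt0_pi uv_pi; have := sin2cos2 (angle u v).
rewrite (cos_angle _ _ su sv) => s2.
transitivity ((1 - dot u v ^+ 2) / sin (angle u v) ^+ 2).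
  by field; rewrite lt0r_neq0.
by rewrite -s2 divff // expf_neq0 // lt0r_neq0.
Qed.

Lemma angle_geodesic u v (s t : R) : sphere u -> sphere v ->
  0 < angle u v < pi -> 0 <= s -> s <= t -> t <= 1 ->
  angle (geodesic u v s) (geodesic u v t) = (t - s) * angle u v.
Proof.
move=> su sv uv_pi s0 st t1; have [d0 d1] := dot_direction _ _ su sv uv_pi.
have /andP[a0 api] := uv_pi.
rewrite {1}/angle /geodesic.
set th := angle u v; move: (direction u v) d0 d1 => d d0 d1.
have -> : dot (cos (s * th) *: u + sin (s * th) *: d)
    (cos (t * th) *: u + sin (t * th) *: d) = cos ((t - s) * th).
  rewrite mulrBl cosB !dotE (dotC d u) d0 d1 sphereP //; ring.
rewrite cosK // in_itv /=; apply/andP; split.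
  by rewrite mulr_ge0 ?subr_ge0 // ltW.
apply: le_trans (ltW api); rewrite -[leRHS]mul1r ler_wpM2r //; first exact: ltW.
by lra.
Qed.

(** Every partition gives the same sum, since distances along a geodesic are
proportional to differences of parameters. *)
Lemma curve_length_geodesic u v : sphere u -> sphere v ->
  0 < angle u v < pi -> curve_length (geodesic u v) = (angle u v)%:E.
Proof.
move=> su sv uv_pi.
have sumE s : itv_partition (0 : R) 1 s ->
    \sum_(0 <= n < size s) angle (geodesic u v (nth 1 (0 :: s) n))
      (geodesic u v (nth 1 (0 :: s) n.+1)) = angle u v.
  move=> hs; pose f n := nth 1 (0 :: s) n * angle u v.
  transitivity (\sum_(0 <= n < size s) (f n.+1 - f n)).
    rewrite !big_nat; apply: eq_bigr => n /= ns.
    rewrite angle_geodesic //; first by rewrite mulrBl.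
    - by apply: itv_partition_nth_ge hs => //; exact: ltnW.
    - case: hs => /(pathP 1) h _; exact/ltW/h.
    - exact: (@itv_partition_nth_le _ _ 0 1 s n.+1).
  rewrite telescope_sumr // /f (itv_partition_nth_size _ hs) /=; ring.
rewrite /curve_length -[RHS]ereal_sup1; congr ereal_sup.
apply/seteqP; split => [_ [s hs <-]|_ ->]; first by rewrite /= sumE.
by exists [:: 1]; [exact: itv_partition1|rewrite sumE //; exact: itv_partition1].
Qed.

End Edges.

(** * First-order growth of angles *)

Section Growth.
Context {R : realType}.
Implicit Types u v x y : 'rV[R]_3.

Lemma dot_displaced_tangent u v (t : R) : sphere u -> tangent u v ->
  dot (u + t *: v) (u + t *: v) = 1 + t ^+ 2 * dot v v.
Proof. by move=> /sphereP uu uv; rewrite !dotE (dotC v u) uv uu; ring. Qed.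

Lemma sphere_displaced u v (t : R) : sphere u -> tangent u v ->
  sphere (normalize (u + t *: v)).
Proof.
move=> su tv; apply: sphere_normalize; rewrite dot_displaced_tangent //.
by have := dot_ge0 v; have := sqr_ge0 t; nra.
Qed.

Lemma enorm_displaced u v (t : R) : sphere u -> tangent u v ->
  1 <= enorm (u + t *: v) <= 1 + t ^+ 2 * dot v v.
Proof.
move=> su tv; rewrite /enorm dot_displaced_tangent //.
have : 0 <= t ^+ 2 * dot v v by rewrite mulr_ge0 ?sqr_ge0 ?dot_ge0.
move: (t ^+ 2 * dot v v) => p p0.
have := sqr_sqrtr (addr_ge0 ler01 p0); have := sqrtr_ge0 (1 + p).
move: (Num.sqrt (1 + p)) => e e0 ep.
by apply/andP; split; nra.
Qed.

(** The numerator is the expansion of the dot product of two displaced points,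
and [D] the product of their norms, which normalization divides by.  As
[D = 1 + O(t^2)], it does not disturb a first-order descent below [K]; a strict
inequality [d < K] leaves room for any slope. *)
Lemma quotient_descent (d a b M K : R) : -1 <= K <= 1 -> 0 <= M ->
  d < K \/ (d = K /\ a < 0) ->
  exists2 e, 0 < e & forall t D, 0 < t -> t < e -> 1 <= D -> D <= 1 + M * t ^+ 2 ->
    (d + a * t + b * t ^+ 2) / D <= K - e * t.
Proof.
move=> K1 M0 dK.
(* The term [2 * M * t ^+ 2] pays for the denominator, as [`|K - e * t| <= 2]. *)
have [c [c0 [t1 t10 num_le]]] : exists c, 0 < c /\ exists2 t1, 0 < t1 &
    forall t, 0 < t -> t < t1 -> d + a * t + b * t ^+ 2 + 2 * M * t ^+ 2 <= K - c * t.
  have B0 := ler_norm b; have A0 := ler_norm a; have := normr_ge0 a; have := normr_ge0 b.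
  case: dK => [dK|[-> a0]] nb na.
    exists 1; split => //; exists (Num.min 1 ((K - d) / (`|a| + `|b| + 1 + 2 * M))).
      rewrite lt_min ltr01 /= divr_gt0 //; lra.
    move=> t t0; rewrite lt_min ltr_pdivlMr; last by lra.
    move=> /andP[t1 ht].
    have tt : t ^+ 2 <= t by rewrite expr2; nra.
    have tt0 : 0 <= t ^+ 2 by rewrite sqr_ge0.
    have h1 : a * t <= `|a| * t by rewrite ler_wpM2r // ltW.
    have h2 : b * t ^+ 2 <= `|b| * t.
      by apply: le_trans (_ : `|b| * t ^+ 2 <= _); rewrite ?ler_wpM2r ?ler_wpM2l.
    have h3 : M * t ^+ 2 <= M * t by rewrite ler_wpM2l.
    by nra.
  exists (- a / 2); split; first by lra.
  exists ((- a / 2) / (`|b| + 1 + 2 * M)); first by rewrite divr_gt0 //; lra.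
  move=> t t0; rewrite ltr_pdivlMr; last by lra.
  move=> ht.
  have : (b + 2 * M) * t <= - a / 2.
    apply: le_trans (ltW ht); rewrite mulrC ler_wpM2l //; [exact: ltW|lra].
  move=> h; have := ler_wpM2r (ltW t0) h; rewrite expr2; lra.
exists (Num.min (Num.min c 1) t1); first by rewrite !lt_min c0 t10 ltr01.
move=> t D t0; rewrite !lt_min => /andP[/andP[tc t1'] tt1] D1 DM.
set e := Num.min _ _.
have e_le : e <= c by rewrite /e !ge_min lexx.
have e_le1 : e <= 1 by rewrite /e !ge_min lexx orbT.
have e0 : 0 < e by rewrite /e !lt_min c0 t10 ltr01.
rewrite ler_pdivrMr; last by lra.
apply: le_trans (_ : K - c * t - 2 * M * t ^+ 2 <= _).
  by have := num_le t t0 tt1; lra.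
have et : e * t <= c * t by rewrite ler_wpM2r // ltW.
have et1 : e * t <= 1 by nra.
have et0 : 0 < e * t by rewrite mulr_gt0.
have h : - (2 * (D - 1)) <= (K - e * t) * (D - 1).
  by rewrite -mulNr ler_wpM2r //; lra.
have hM : M * t ^+ 2 >= 0 by rewrite mulr_ge0 // sqr_ge0.
by lra.
Qed.

(** First variation of the angle, as a one-sided bound.  For unit vectors, the
dot product varies at the rate [dot x v + dot u y], and the angle grows when
this is negative. *)
Lemma angle_displaced u v x y (th : R) : sphere u -> sphere v ->
  tangent u x -> tangent v y -> 0 <= th <= pi ->
  th < angle u v \/ (th = angle u v /\ dot x v + dot u y < 0) ->
  exists2 e, 0 < e & forall t, 0 < t -> t < e ->
    th + e * t <= angle (normalize (u + t *: x)) (normalize (v + t *: y)).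
Proof.
move=> su sv tx ty th_itv grow.
have xx := dot_ge0 x; have yy := dot_ge0 y.
(* Product of the bounds [1 + t ^+ 2 * dot x x] and [1 + t ^+ 2 * dot y y] on
   the norms, for [t <= 1]. *)
pose M := dot x x + dot y y + dot x x * dot y y.
have M0 : 0 <= M by rewrite !addr_ge0 // mulr_ge0.
have [||e e0 He] := @quotient_descent (dot u v) (dot x v + dot u y) (dot x y)
  M (cos th) _ M0.
- by rewrite cos_geN1 cos_le1.
- case: grow => [h|[-> h]]; last by right; rewrite cos_angle.
  by left; rewrite -cos_angle // ltr_cos // in_itv ?angle_itv.
have e1 : 0 < Num.min e 1 by rewrite lt_min e0 ltr01.
exists (Num.min e 1) => // t t0; rewrite lt_min => /andP[te t1].
have ht : Num.min e 1 * t <= e * t by rewrite ler_wpM2r ?ge_min ?lexx // ltW.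
apply: angle_growth; [exact: sphere_displaced..|exact: th_itv| |].
  by rewrite mulr_ge0 // ltW.
apply: le_trans (_ : cos th - e * t <= _); last by lra.
have /andP[x1 x2] := enorm_displaced _ _ t su tx.
have /andP[y1 y2] := enorm_displaced _ _ t sv ty.
pose D := enorm (u + t *: x) * enorm (v + t *: y).
have -> : dot (normalize (u + t *: x)) (normalize (v + t *: y)) =
    (dot u v + (dot x v + dot u y) * t + dot x y * t ^+ 2) / D.
  rewrite /normalize /D !dotE; field.
  by rewrite !lt0r_neq0 //; lra.
apply: He => //.
  by rewrite /D; nra.
have t2 : 0 <= t ^+ 2 by rewrite sqr_ge0.
have t2' : t ^+ 2 <= 1 by rewrite expr2; nra.
apply: le_trans (_ : (1 + t ^+ 2 * dot x x) * (1 + t ^+ 2 * dot y y) <= _).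
  by rewrite /D ler_pM //; lra.
have h : (t ^+ 2 * (dot x x * dot y y)) * t ^+ 2 <= t ^+ 2 * (dot x x * dot y y).
  rewrite ler_piMr //; exact: mulr_ge0 t2 (mulr_ge0 xx yy).
by rewrite /M; lra.
Qed.

End Growth.

(** * Critical configurations are balanced *)

Section Critical.
Context {R : realType} {N : nat}.
Implicit Types U V : 'I_N -> 'rV[R]_3.

Lemma rho_ge U (r : R) : r <= pi / 2 ->
  (forall i j, i != j -> 2 * r <= angle (U i) (U j)) -> r <= rho U.
Proof.
move=> rpi hr; rewrite /rho.
suff : 2 * r <= \big[Num.min/pi]_(p : 'I_N * 'I_N | p.1 != p.2) angle (U p.1) (U p.2).
  by lra.
by apply/bigmin_geP; split; [lra|move=> [i j] /= /hr].
Qed.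

Lemma rho_le_angle U i j : i != j -> 2 * rho U <= angle (U i) (U j).
Proof.
move=> ij; rewrite /rho mulrA divff ?pnatr_eq0 // mul1r.
by apply/bigmin_leP; right; exists (i, j).
Qed.

Lemma rho_gt0 U : Conf U -> 0 < rho U.
Proof.
move=> [sU injU]; rewrite /rho mulr_gt0 // ?invr_gt0 //.
apply/bigmin_gtP; split=> [|[i j] /= ij]; first exact: pi_gt0.
by apply: angle_gt0 => // /injU; apply/eqP.
Qed.

(** Otherwise all pairs would be antipodal, and two points would share the
antipode of a third one. *)
Lemma two_rho_lt_pi U : (3 <= N)%N -> Conf U -> 2 * rho U < pi.
Proof.
move=> hN [sU injU].
have h0 : (0 < N)%N by apply: leq_trans hN.
have h1 : (1 < N)%N by apply: leq_trans hN.
pose i0 := Ordinal h0; pose i1 := Ordinal h1; pose i2 := Ordinal hN.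
rewrite ltNge; apply/negP => hpi.
have antip i : i != i0 -> U i = - U i0.
  move=> ii; apply: contrapT => nanti.
  have := angle_ltpi _ _ (sU i) (sU i0) nanti.
  by rewrite ltNge => /negP; apply; apply: le_trans hpi _; exact: rho_le_angle.
have /injU/eqP : U i1 = U i2 by rewrite (antip i1) // (antip i2).
by [].
Qed.

Lemma contact_angle U i j : (3 <= N)%N -> Conf U -> contact U i j ->
  0 < angle (U i) (U j) < pi.
Proof.
move=> hN cU /andP[_ /eqP->]; rewrite two_rho_lt_pi // andbT.
by rewrite mulr_gt0 ?rho_gt0.
Qed.

Lemma contact_sym U i j : contact U i j = contact U j i.
Proof. by rewrite /contact eq_sym angleC. Qed.

(** The quantitative form of first-order ascent: if all contact angles grow to
first order, [rho] grows at least linearly.  Pairs not in contact have a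
positive margin, which [angle_displaced] also turns into a linear bound. *)
Lemma rho_displace U V : (3 <= N)%N -> Conf U ->
  (forall i, tangent (U i) (V i)) ->
  (forall i j, contact U i j -> dot (V i) (U j) + dot (U i) (V j) < 0) ->
  exists2 e, 0 < e & forall t, 0 < t -> t < e ->
    rho U + e * t <= rho (displace U V t).
Proof.
move=> hN cU tV grow; have [sU _] := cU.
have rpi := two_rho_lt_pi _ hN cU; have r0 := rho_gt0 _ cU.
pose P (p : 'I_N * 'I_N) e := p.1 != p.2 -> forall t, 0 < t -> t < e ->
  2 * rho U + e * t <= angle (displace U V t p.1) (displace U V t p.2).
have [p d e d0 de Pe pp t t0 td|p _|e e0 He] := common_threshold (index_enum _) P.
- apply: le_trans (Pe pp t t0 (lt_le_trans td de)).
  by rewrite lerD2l ler_wpM2r // ltW.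
- have [pp|pp] := boolP (p.1 != p.2); last by exists 1 => // h; rewrite h in pp.
  have [||||e e0 He] := angle_displaced _ _ (V p.1) (V p.2) (2 * rho U) (sU p.1) (sU p.2).
  + exact: tV.
  + exact: tV.
  + by apply/andP; split; [rewrite mulr_ge0 // ltW|exact: ltW].
  + have := rho_le_angle U _ _ pp; rewrite le_eqVlt => /predU1P[h|]; last by left.
    by right; split => //; apply: grow; rewrite /contact pp h eqxx.
  by exists e => // _; exact: He.
(* The minimum defining [rho] also ranges over its neutral element [pi], hence
   a constraint keeping [rho U + t] below [pi / 2]. *)
pose q := (pi - 2 * rho U) / 2.
exists (Num.min (e / 2) (Num.min 1 q)).
  by rewrite !lt_min ltr01 !divr_gt0 // subr_gt0.
move=> t t0; rewrite !lt_min => /and3P[te t1 tq].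
set m := Num.min _ _.
have me : m <= e / 2 by rewrite ge_min lexx.
have mq : m <= 1 by rewrite !ge_min lexx orbT.
have m0 : 0 <= m by rewrite !le_min ler01 !divr_ge0 ?subr_ge0 // ltW.
have met : m * t <= e / 2 * t by rewrite ler_wpM2r // ltW.
have mt : m * t <= t by rewrite ler_piMl // ltW.
apply: rho_ge => [|i j ij]; first by rewrite /q in tq; lra.
have te' : t < e by lra.
by have := He (i, j) (mem_index_enum _) ij t t0 te'; rewrite /=; lra.
Qed.

Lemma critical_no_ascent U V : (3 <= N)%N -> Conf U -> critical U ->
  (forall i, tangent (U i) (V i)) ->
  ~ (forall i j, contact U i j -> dot (V i) (U j) + dot (U i) (V j) < 0).
Proof.
move=> hN cU critU tV grow.
have [e e0 He] := rho_displace _ _ hN cU tV grow.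
have /eqoP small := critU V tV.
have /nbhs_ballP[d /= d0 Hd] := small (e / 2) (divr_gt0 e0 (ltr0Sn _ 1)).
pose t := Num.min d e / 2.
have m0 : 0 < Num.min d e by rewrite lt_min d0.
have md : Num.min d e <= d by rewrite ge_min lexx.
have me : Num.min d e <= e by rewrite ge_min lexx orbT.
have t0 : 0 < t by rewrite divr_gt0.
have te : t < e by rewrite /t; lra.
have := Hd t; rewrite /ball /= sub0r normrN (gtr0_norm t0).
have td : t < d by rewrite /t; lra.
move=> /(_ td); have := He t t0 te; have := mulr_gt0 e0 t0 => et0 grow_t.
have le_max : rho (displace U V t) - rho U <= Num.max (rho (displace U V t) - rho U) 0.
  by rewrite le_max lexx.
by have := ler_norm (Num.max (rho (displace U V t) - rho U) 0); lra.
Qed.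

Lemma sum_pairs_row (Q : rel 'I_N) (F : 'I_N -> 'I_N -> R) i :
  (forall k j, k != i -> F k j = 0) ->
  \sum_(q | Q q.1 q.2) F q.1 q.2 = \sum_(j | Q i j) F i j.
Proof.
move=> F0; rewrite -(pair_big_dep predT Q F) /= (bigD1 i) //=.
by rewrite [X in _ + X]big1 ?addr0 // => k ki; apply: big1 => j _; exact: F0.
Qed.

(** Gordan's alternative is applied to all ordered contact pairs; adding the
weights of the two orientations of an edge gives a symmetric stress. *)
Lemma critical_balanced U : (3 <= N)%N -> Conf U -> critical U -> balanced U.
Proof.
move=> hN cU critU; have [sU _] := cU.
pose out i j := outward (U i) (U j).
pose a (p : 'I_N * 'I_N) V := dot (V p.1) (out p.1 p.2) + dot (V p.2) (out p.2 p.1).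
pose s := [seq p <- index_enum _ | contact U p.1 p.2].
have us : uniq s by rewrite filter_uniq ?index_enum_uniq.
have lin_a p : scalar (a p).
  by move=> c V V'; rewrite /a !fctE !dotE; ring.
have [[V V_gt0]|[w [w_ge0 [p ps wp_gt0] sum_w]]] := gordan s a us lin_a.
  exfalso.
  (* The rates only see the tangential part of [V]. *)
  pose V' i := V i - dot (V i) (U i) *: U i.
  have tV' i : tangent (U i) (V' i).
    by rewrite /tangent /= /V' !dotE sphereP // (dotC (U i)); ring.
  apply: (critical_no_ascent U V') => // i j cij.
  have ij_pi := contact_angle _ _ _ hN cU cij.
  have s0 := sin_gt0_pi ij_pi.
  have : 0 < a (i, j) V by apply: V_gt0; rewrite mem_filter cij mem_index_enum.
  rewrite /a /out /= /outward !directionE //; last by rewrite angleC.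
  rewrite (angleC (U j)) !cos_angle //.
  have si0 : 0 < (sin (angle (U i) (U j)))^-1 by rewrite invr_gt0.
  rewrite /V' !dotE; rewrite (dotC (U i) (V j)).
  set S := (sin _)^-1; set K := dot (U i) (U j).
  move=> h.
  have : 0 < S * - ((dot (V i) (U j) - dot (V i) (U i) * K) +
      (dot (V j) (U i) - dot (V j) (U j) * K)).
    apply: lt_le_trans h _; rewrite le_eqVlt; apply/orP; left; apply/eqP; ring.
  by rewrite pmulr_rgt0 // oppr_gt0; lra.
pose W i j := w (i, j) + w (j, i).
have Wpos i j : 0 <= W i j by rewrite addr_ge0.
exists W; split; last first.
  exists p.1, p.2; move: ps; rewrite mem_filter => /andP[cp _]; split => //.
  by rewrite gt_eqF // ltr_pwDl // -surjective_pairing.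
split=> [i j _|i]; first by split => //; rewrite /W addrC.
set F := \sum_(j | _) _.
(* Test the identity on the displacement by the resultant itself at the point
   [i], so that it computes the square of the norm of the resultant. *)
apply: dot_eq0; set x := {2}F.
pose V k : 'rV[R]_3 := if k == i then x else 0.
have := sum_w V; rewrite big_filter /a.
under eq_bigr => q _ do rewrite mulrDr.
rewrite big_split /=.
have Vi : V i = x by rewrite /V eqxx.
have Vk k : k != i -> V k = 0 by rewrite /V => /negbTE ->.
have -> : \sum_(q | contact U q.1 q.2) w q * dot (V q.1) (out q.1 q.2) =
    \sum_(j | contact U i j) w (i, j) * dot x (out i j).
  rewrite -Vi -(sum_pairs_row (contact U) (fun k j => w (k, j) * dot (V k) (out k j))).
    by apply: eq_bigr => -[].
  by move=> k j ki; rewrite Vk // dot0l mulr0.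
have -> : \sum_(q | contact U q.1 q.2) w q * dot (V q.2) (out q.2 q.1) =
    \sum_(j | contact U i j) w (j, i) * dot x (out i j).
  rewrite -Vi -(sum_pairs_row (contact U) (fun k j => w (j, k) * dot (V k) (out k j))).
    rewrite (reindex_inj (can_inj swap_pairK)) /=.
    by apply: eq_big => -[k j] //=; rewrite contact_sym.
  by move=> k j ki; rewrite Vk // dot0l mulr0.
rewrite -big_split /= => <-; rewrite dot_suml; apply: eq_bigr => j _.
by rewrite dotZl /W (dotC x); ring.
Qed.

End Critical.

Theorem theorem4p10 (R : realType) (N : nat) (hN : (3 <= N)%N) (theta : R)
    (htheta : critical_value N (theta / 2)) :
  exists U : 'I_N -> 'rV[R]_3,
    [/\ Conf U, balanced U, rho U = theta / 2,
        contact_vertices U `<=` [set u | exists i : 'I_N, u = U i]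
      & forall e : R -> 'rV[R]_3, contact_edges U e ->
          curve_length e = theta%:E].
Proof.
have [U [cU critU rhoU]] := htheta.
exists U; split=> // [|_ [i _ <-]|_ [i [j [cij ->]]]].
- exact: critical_balanced.
- by exists i.
- have [sU _] := cU.
  rewrite curve_length_geodesic //; last exact: contact_angle cij.
  by case/andP: cij => _ /eqP ->; rewrite rhoU; congr (_%:E); field.
Qed.
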